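(* Let $m\ge 2$ be an integer and let $(c_{j_1,j_2,\ldots,j_m})_{(j_1,\ldots,j_m)\in\mathbb{N}^m}$ be complex numbers. If the $m$-multiple series $$\sum_{j_1=0}^\infty\sum_{j_2=0}^\infty\cdots\sum_{j_m=0}^\infty c_{j_1,j_2,\ldots,j_m}$$ converges regularly, then for every permutation $\{\sigma(1),\sigma(2),\ldots,\sigma(m)\}$ of $\{1,2,\ldots,m\}$ its sum can be computed by successive summation, that is, $$\sum_{j_{\sigma(1)}=0}^\infty\Big(\sum_{j_{\sigma(2)}=0}^\infty\Big(\cdots\Big(\sum_{j_{\sigma(m)}=0}^\infty c_{j_1,j_2,\ldots,j_m}\Big)\cdots\Big)\Big)=s,$$ where $s$ is the sum of the $m$-multiple series in Pringsheim's sense.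
   Context: Here $\mathbb{N}=\{0,1,2,\ldots\}$. The $m$-fold rectangular partial sums are $s(l_1,\ldots,l_m)=\sum_{j_1=0}^{l_1}\cdots\sum_{j_m=0}^{l_m}c_{j_1,\ldots,j_m}$, $(l_1,\ldots,l_m)\in\mathbb{N}^m$. Convergence in Pringsheim's sense: the multiple series converges in Pringsheim's sense to the sum $s\in\mathbb{C}$ if for every $\varepsilon>0$ there exists $\lambda_1=\lambda_1(\varepsilon)\in\mathbb{N}$ such that $|s(l_1,\ldots,l_m)-s|<\varepsilon$ whenever $\min\{l_1,\ldots,l_m\}>\lambda_1$. Regular convergence: for $0\le k_p\le l_p$ ($p=1,\ldots,m$) put $s(k_1,l_1;\ldots;k_m,l_m)=\sum_{j_1=k_1}^{l_1}\cdots\sum_{j_m=k_m}^{l_m}c_{j_1,\ldots,j_m}$. The multiple series converges regularly if for every $\varepsilon>0$ there exists $\lambda_2=\lambda_2(\varepsilon)\in\mathbb{N}$ such that $|s(k_1,l_1;\ldots;k_m,l_m)|<\varepsilon$ whenever $\max\{k_1,\ldots,k_m\}>\lambda_2$ and $0\le k_p\le l_p$ for $p=1,\ldots,m$. Regular convergence implies convergence in Pringsheim's sense, so the sum $s$ is well defined. The displayed successive sum consists of ordinary single series of complex numbers, evaluated from the innermost outwards; the equality includes the assertion that all of these single series converge. *)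

(* Defs.v *)
From HB Require Import structures.
From mathcomp Require Import all_boot all_order all_fingroup all_algebra.
From mathcomp Require Import complex.
From mathcomp Require Import all_classical all_reals topology normedtype sequences.

Set Implicit Arguments.
Unset Strict Implicit.
Unset Printing Implicit Defensive.

Import Order.TTheory GRing.Theory Num.Theory.
Import numFieldNormedType.Exports.

Local Open Scope classical_set_scope.
Local Open Scope ring_scope.
Local Open Scope complex_scope.

Notation multi_index m := {ffun 'I_m -> nat}.

Section MultipleSeries.
Variables (R : realType) (m : nat) (c : multi_index m -> R[i]).
Implicit Types (k l j : multi_index m) (s : R[i]).

Definition box_sum k l : R[i] :=
  \sum_(j : {dffun forall p : 'I_m, 'I_(l p).+1} | [forall p, k p <= j p]%N)
    c [ffun p => j p : nat].

Definition partial_sum l : R[i] := box_sum [ffun=> 0%N] l.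

(* The condition forall p, L < l p says min l > L. *)
Definition pringsheim_cvg s : Prop :=
  forall e : R, 0 < e -> exists L : nat,
    forall l, (forall p, (L < l p)%N) -> `|partial_sum l - s| < e%:C.

Definition regular_cvg : Prop :=
  forall e : R, 0 < e -> exists L : nat,
    forall k l, (L < \max_(p < m) k p)%N -> (forall p, (k p <= l p)%N) ->
      `|box_sum k l| < e%:C.

Definition set_index j (p : 'I_m) (n : nat) : multi_index m :=
  [ffun q => if q == p then n else j q].

(* successive_sum ps j s: summing c successively over the indices in ps, with  *)
(* the head of ps outermost and the other indices fixed as in j, every single  *)
(* series met on the way converges, and the outermost one has sum s.           *)
Fixpoint successive_sum (ps : seq 'I_m) j s : Prop :=
  if ps is p :: ps' then
    exists t : nat -> R[i],
      (forall n, successive_sum ps' (set_index j p n) (t n)) /\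
      series t @ \oo --> (s : R[i]^o)
  else s = c j.

End MultipleSeries.

(* Main.v *)
(* Regular convergence bounds box sums uniformly: raising an upper corner from *)
(* l to l' changes a box sum by little as soon as every coordinate that moves  *)
(* starts beyond some L, whatever the coordinates that stay fixed. Hence, for  *)
(* a list D of indices, the sums over the cubes in the directions of D (other  *)
(* indices frozen as in j) are Cauchy, with limit T D j. The partial sums of   *)
(* T D over one more index p are limits of box sums in which p stays at N and  *)
(* D goes to infinity; by the uniform bound they are close to the cube sum of  *)
(* side N over p :: D, so the series in p converges to T (p :: D) j. When D    *)
(* lists all the indices, T D j is the Pringsheim sum.                         *)

Require Import Defs.
From HB Require Import structures.
From mathcomp Require Import all_boot all_order all_fingroup all_algebra.
From mathcomp Require Import complex.
From mathcomp Require Import all_classical all_reals topology normedtype sequences.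
From mathcomp Require Import lra.

Set Implicit Arguments.
Unset Strict Implicit.
Unset Printing Implicit Defensive.

Import Order.TTheory GRing.Theory Num.Theory.
Import numFieldNormedType.Exports.

Local Open Scope classical_set_scope.
Local Open Scope ring_scope.
Local Open Scope complex_scope.

(** The heart is an interchange of limits. In [section_sum_series] one direction is cut at [N] while
    those of [D] go to infinity; the bound of [regular_cvg_box_sum] does not depend on how far they
    go, so the iterated limit agrees with the limit along cubes. Induction on the list of indices
    ([successive_section_sum]) then gives the successive sum in any order, and
    [pringsheim_section_sum] and [pringsheim_section_sum_unique] identify the limit along full cubes
    with the Pringsheim sum. *)

Section ComplexSequences.
Variable R : realType.
Implicit Types (u : nat -> R[i]) (s z : R[i]).

(** * Complex limits with real radii, and completeness *)

Lemma cvg_complexP u s : u @ \oo --> (s : R[i]^o) <->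
  forall e : R, 0 < e -> exists L, forall n, (L <= n)%N -> `|u n - s| <= e%:C.
Proof.
pose cvgP := @cvgrPdist_le R[i] R[i]^o nat \oo _ u s.
split=> [/cvgP us e e0|us].
  have /us[L _ uL] : 0 < e%:C by rewrite ltcR.
  by exists L => n Ln; rewrite distrC; exact: uL.
apply/cvgP => e e0.
(* In the order of [R[i]], a positive element is real. *)
have eE : e = (complex.Re e)%:C by rewrite RRe_real ?gtr0_real.
have /us[L uL] : 0 < complex.Re e by rewrite -ltcR -eE.
by exists L => // n /= Ln; rewrite distrC eE; exact: uL.
Qed.

Lemma normc_le_Re_Im z : `|z| <= (`|complex.Re z| + `|complex.Im z|)%:C.
Proof.
case: z => a b; rewrite normc_def /= lecR.
rewrite -(ler_pXn2r (n := 2)) ?nnegrE ?sqrtr_ge0 ?addr_ge0//.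
rewrite sqr_sqrtr ?addr_ge0 ?sqr_ge0// sqrrD !real_normK ?num_real//.
by rewrite addrAC lerDl mulrn_wge0// mulr_ge0.
Qed.

Lemma real_cauchy_cvg (v : nat -> R) :
  (forall e : R, 0 < e -> exists L, forall n, (L <= n)%N -> `|v n - v L| <= e) ->
  exists s : R, v @ \oo --> s.
Proof.
move=> vc; suff : cvg (v @ \oo) by move=> /cvg_ex.
apply/cauchy_cvgP/cauchy_exP => e e0.
have /vc[L vL] : 0 < e / 2 by rewrite divr_gt0.
exists (v L); exists L => // n /= Ln.
rewrite /ball_ /ball /= distrC (le_lt_trans (vL _ Ln))//.
by rewrite ltr_pdivrMr// ltr_pMr// ltr1n.
Qed.

Lemma normc_ge_Im z : `|complex.Im z|%:C <= `|z|.
Proof.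
case: z => a b; rewrite normc_def /= lecR -sqrtr_sqr ler_wsqrtr//.
by rewrite lerDr sqr_ge0.
Qed.

Lemma complex_cauchy_cvg u :
  (forall e : R, 0 < e ->
    exists L, forall n, (L <= n)%N -> `|u n - u L| <= e%:C) ->
  exists s, u @ \oo --> (s : R[i]^o).
Proof.
move=> uc.
have [e /uc[L uL]|a ua] := @real_cauchy_cvg (fun n => complex.Re (u n)).
  exists L => n /uL; rewrite -lecR; apply: le_trans.
  by rewrite /= -raddfB normc_ge_Re.
have [e /uc[L uL]|b ub] := @real_cauchy_cvg (fun n => complex.Im (u n)).
  exists L => n /uL; rewrite -lecR; apply: le_trans.
  by rewrite /= -raddfB normc_ge_Im.
exists (a +i* b); apply/cvg_complexP => e e0.
have e20 : 0 < e / 2 by rewrite divr_gt0.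
move/cvgrPdist_le: ua => /(_ _ e20)[L1 _ uL1].
move/cvgrPdist_le: ub => /(_ _ e20)[L2 _ uL2].
exists (maxn L1 L2) => n; rewrite geq_max => /andP[n1 n2].
rewrite (le_trans (normc_le_Re_Im _))// lecR [leRHS]splitr !raddfB /=.
by rewrite lerD// distrC; [exact: uL1|exact: uL2].
Qed.

Lemma cvg_dist_le u s (a : R[i]) (e : R) L : u @ \oo --> (s : R[i]^o) ->
  (forall n, (L <= n)%N -> `|u n - a| <= e%:C) -> `|s - a| <= e%:C.
Proof.
move=> /cvg_complexP us ua; rewrite normc_def lecR.
apply/ler_addgt0Pl => d /us[N uN]; rewrite -lecR -normc_def.
have := uN _ (leq_maxr L N); have := ua _ (leq_maxl L N) => uaL uNs.
rewrite -(subrKA (u (maxn L N))) (le_trans (ler_normD _ _))// raddfD lerD//.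
by rewrite distrC.
Qed.

End ComplexSequences.

(** * Cutting boxes, and the uniform bound *)

Section Boxes.
Variables (R : realType) (m : nat) (c : multi_index m -> R[i]).
Implicit Types (k l j : multi_index m) (p : 'I_m) (D : seq 'I_m).

(** The index type of a box sum depends on its upper corner; embedding boxes in a common cube makes
    sums with different corners comparable. *)
Lemma box_sum_bounded (M : nat) k l : (forall p, l p < M)%N ->
  box_sum c k l =
  \sum_(f : {ffun 'I_m -> 'I_M} | [forall p, k p <= f p <= l p]%N)
    c [ffun p => f p : nat].
Proof.
move=> lM.
pose h (j : {dffun forall p : 'I_m, 'I_(l p).+1}) : {ffun 'I_m -> 'I_M} :=
  [ffun p => widen_ord (lM p) (j p)].
pose h' (f : {ffun 'I_m -> 'I_M}) : {dffun forall p : 'I_m, 'I_(l p).+1} :=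
  [ffun p => inord (f p)].
rewrite (reindex_onto h h') => [|f /forallP kfl]; last first.
  apply/ffunP => p; rewrite !ffunE; apply/val_inj; rewrite /= inordK//.
  by have /andP[] := kfl p.
rewrite /box_sum; apply: eq_big => [j|j _].
  have -> : h' (h j) == j.
    by apply/eqP/ffunP => p; rewrite !ffunE /= inord_val.
  rewrite andbT; apply: eq_forallb => p.
  by rewrite ffunE /= -[(j p <= l p)%N]ltnS ltn_ord andbT.
by congr c; apply/ffunP => p; rewrite !ffunE.
Qed.

(** The box is cut between [a] and [a.+1] in direction [p]; the bounds on [a] allow either piece to
    be empty. *)
Lemma box_sum_split k l p (a : nat) : (k p <= a.+1)%N -> (a <= l p)%N ->
  box_sum c k l =
  box_sum c k (set_index l p a) + box_sum c (set_index k p a.+1) l.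
Proof.
move=> ka al; pose M := (\max_p l p).+1.
have lM q : (l q < M)%N by rewrite ltnS; exact: leq_bigmax.
have lM' q : (set_index l p a q < M)%N.
  by rewrite ffunE; case: eqP => // _; exact: leq_ltn_trans al (lM p).
rewrite !(@box_sum_bounded M)//.
rewrite (bigID (fun f : {ffun 'I_m -> 'I_M} => f p <= a)%N)/=.
congr (_ + _); apply: eq_bigl => f; apply/andP/forallP.
- move=> [/forallP kfl fa] q; rewrite ffunE; case: eqP => [->|_]//.
  by rewrite fa; have /andP[->] := kfl p.
- move=> kfl; split.
    apply/forallP => q; have := kfl q; rewrite ffunE; case: eqP => [->|//].
    by move=> /andP[-> /leq_trans->].
  by have := kfl p; rewrite ffunE eqxx => /andP[].
- move=> [/forallP kfl fa] q; rewrite ffunE; case: eqP => [->|_]//.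
  by rewrite ltnNge fa; have /andP[_ ->] := kfl p.
- move=> kfl; split.
    apply/forallP => q; have := kfl q; rewrite ffunE; case: eqP => [->|//].
    by move=> /andP[/(leq_trans ka)-> ->].
  by have := kfl p; rewrite ffunE eqxx -ltnNge => /andP[].
Qed.

Lemma box_sum_point j : box_sum c j j = c j.
Proof.
pose M := (\max_p j p).+1.
have jM q : (j q < M)%N by rewrite ltnS; exact: leq_bigmax.
rewrite (@box_sum_bounded M)//.
rewrite (big_pred1 [ffun p => Ordinal (jM p)]) => [|f /=].
  by congr c; apply/ffunP => p; rewrite !ffunE.
apply/forallP/eqP => [jf|-> p]; last by rewrite ffunE /= leqnn.
by apply/ffunP => p; apply/val_inj/eqP; rewrite ffunE /= eqn_leq andbC jf.
Qed.

Lemma box_sum_empty k l p : (l p < k p)%N -> box_sum c k l = 0.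
Proof.
move=> lk; rewrite /box_sum big_pred0// => j.
apply/negbTE/forallPn; exists p.
by rewrite -ltnNge (leq_ltn_trans _ lk)// -ltnS.
Qed.

Lemma set_indexK j p (a b : nat) :
  set_index (set_index j p a) p b = set_index j p b.
Proof. by apply/ffunP => q; rewrite !ffunE; case: eqP. Qed.

(** This turns a partial sum in direction [p] into a single box sum, to which the uniform bound
    applies. *)
Lemma box_sum_slice k l p (n : nat) :
  box_sum c (set_index k p 0) (set_index l p n) =
  \sum_(0 <= i < n.+1) box_sum c (set_index k p i) (set_index l p i).
Proof.
elim: n => [|n IHn]; first by rewrite big_nat1.
rewrite (@box_sum_split _ _ p n) ?ffunE ?eqxx// !set_indexK IHn.
by rewrite [RHS]big_nat_recr.
Qed.

(* Raise the upper corner from l to l' one coordinate at a time: each step     *)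
(* adds a box whose lower corner exceeds L in that coordinate.                 *)
Lemma regular_cvg_box_sum : regular_cvg c ->
  forall e : R, 0 < e -> exists L : nat, forall k l l',
    (forall p, k p <= l p)%N -> (forall p, l p <= l' p)%N ->
    (forall p, l p = l' p \/ (L <= l p)%N) ->
    `|box_sum c k l' - box_sum c k l| <= e%:C.
Proof.
move=> hc e e0.
(* There are [m] increments of at most this size, one per coordinate; [m.+1] is nonzero for every
   [m]. *)
have e10 : 0 < e / m.+1%:R by rewrite divr_gt0.
have [L cL] := hc _ e10; exists L => k l l' kl ll' lL.
pose h n : multi_index m := [ffun q : 'I_m => if (q < n)%N then l' q else l q].
have hl n q : (l q <= h n q)%N by rewrite ffunE; case: ifP.
have step n : (n < m)%N ->
    `|box_sum c k (h n.+1) - box_sum c k (h n)| <= (e / m.+1%:R)%:C.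
  move=> nm; pose p := Ordinal nm.
  have hn : h n = set_index (h n.+1) p (l p).
    apply/ffunP => q; rewrite !ffunE; case: eqP => [->|/eqP qp].
      by rewrite ltnn.
    by rewrite ltnS [(q <= n)%N]leq_eqVlt -[_ == n]/(q == p) (negbTE qp).
  have hp : h n.+1 p = l' p by rewrite ffunE ltnS leqnn.
  rewrite (@box_sum_split k (h n.+1) p (l p)) ?hp ?ll'//; last first.
    by rewrite (leq_trans (kl p)).
  rewrite -hn addrC addKr.
  (* A coordinate that does not move adds an empty slab; one that moves has [L <= l p], so its slab
     starts at [(l p).+1 > L], where regular convergence applies. *)
  have [ll|l'l] := ltnP (l p) (l' p); last first.
    rewrite (@box_sum_empty _ _ p) ?hp ?ffunE ?eqxx// normr0 lecR.
    by rewrite divr_ge0 // ltW.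
  have [lp|Ll] := lL p; first by rewrite lp ltnn in ll.
  apply/ltW/cL => [|q].
    apply: (@leq_trans (set_index k p (l p).+1 p)); first by rewrite ffunE eqxx.
    exact: leq_bigmax.
  rewrite [set_index _ _ _ q]ffunE; case: eqP => [->|_]; first by rewrite hp.
  exact: leq_trans (kl q) (hl _ _).
have hm : h m = l' by apply/ffunP => q; rewrite ffunE ltn_ord.
have h0 : h 0 = l by apply/ffunP => q; rewrite ffunE.
rewrite -hm -h0 -(telescope_sumr (fun n => box_sum c k (h n)))//.
rewrite (le_trans (ler_norm_sum _ _ _))// big_mkord.
apply: (@le_trans _ _ (\sum_(i < m) (e / m.+1%:R)%:C)).
  by apply: ler_sum => i _; exact: step.
rewrite sumr_const card_ord -raddfMn lecR -[_ *+ m]mulr_natr mulrAC ler_pdivrMr//.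
by rewrite ler_pM2l// ler_nat.
Qed.

(** * Limits along cubes in some of the directions *)

Definition corner D j (n : nat) : multi_index m :=
  [ffun q => if q \in D then n else j q].

Lemma corner_cons p D j n : corner (p :: D) j n = set_index (corner D j n) p n.
Proof. by apply/ffunP => q; rewrite !ffunE inE; case: eqP. Qed.

Lemma set_index_corner p D j (a b : nat) : p \notin D ->
  set_index (corner D j a) p b = corner D (set_index j p b) a.
Proof.
by move=> pD; apply/ffunP => q; rewrite !ffunE; case: eqP => // ->; case: ifPn pD.
Qed.

Lemma corner_le D j (a b : nat) p :
  (a <= b)%N -> (corner D j a p <= corner D j b p)%N.
Proof. by rewrite !ffunE; case: ifP. Qed.

(** Both corners agree with [j] off [D], so the box is a cube in the directions of [D] and a single
    point in the others. *)
Definition section_sum D j n := box_sum c (corner D j 0) (corner D j n).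

Lemma section_sum_cvg : regular_cvg c -> forall D j,
  exists s, section_sum D j @ \oo --> (s : R[i]^o).
Proof.
move=> hc D j; apply: complex_cauchy_cvg => e e0.
have [L cL] := regular_cvg_box_sum hc e0.
exists L => n Ln; apply: cL => p; rewrite ?corner_le//.
by rewrite !ffunE; case: ifP => _; [right|left].
Qed.

Lemma section_sum_series : regular_cvg c ->
  forall (T : seq 'I_m -> multi_index m -> R[i]),
  (forall D j, section_sum D j @ \oo --> (T D j : R[i]^o)) ->
  forall p D j, p \notin D ->
  series (fun n => T D (set_index j p n)) @ \oo --> (T (p :: D) j : R[i]^o).
Proof.
move=> hc T cT p D j pD; apply/cvg_complexP => e e0.
have e20 : 0 < e / 2 by rewrite divr_gt0.
have [L1 cL1] := regular_cvg_box_sum hc e20.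
have /cvg_complexP/(_ _ e20)[L2 cL2] := cT (p :: D) j.
(* [series] at [N.+1] adds the terms of index at most [N], which matches a box of side [N]. *)
exists (maxn L1 L2).+1 => -[//|N]; rewrite ltnS geq_max => /andP[L1N L2N].
rewrite -(subrKA (section_sum (p :: D) j N)) (le_trans (ler_normD _ _))//.
rewrite [e]splitr raddfD lerD ?cL2//.
pose v M := \sum_(0 <= i < N.+1) section_sum D (set_index j p i) M.
have vE M : v M = box_sum c (corner (p :: D) j 0) (set_index (corner D j M) p N).
  rewrite corner_cons box_sum_slice; apply: eq_bigr => i _.
  by rewrite !set_index_corner.
(* As [M] grows, [v M] tends to the partial sum of the series. From the cube of side [N] to the box
   of [v M] only directions of [D] move, all starting at [N >= L1]. *)
apply: (@cvg_dist_le _ v _ _ _ N) => [|M NM].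
  by apply: (@cvg_big R[i]^o) => [|i _]; [exact: add_continuous|exact: cT].
rewrite vE; apply: cL1 => q; rewrite ?corner_le// corner_cons !ffunE.
  by case: eqP => // _; case: ifP.
by case: eqP => [_|_]; [left|case: ifP => _; [right|left]].
Qed.

Lemma successive_section_sum (T : seq 'I_m -> multi_index m -> R[i]) :
  regular_cvg c ->
  (forall D j, section_sum D j @ \oo --> (T D j : R[i]^o)) ->
  forall D j, uniq D -> successive_sum c D j (T D j).
Proof.
move=> hc cT; elim=> [|p D IHD] j /=.
  (* With no direction to sum over, [section_sum] is constantly [c j]. *)
  move=> _; apply/eqP; rewrite -subr_eq0 -normr_le0.
  apply: (cvg_dist_le (L := 0) (cT [::] j)) => n _.
  have cornerE a : corner [::] j a = j by apply/ffunP => q; rewrite ffunE.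
  by rewrite /section_sum !cornerE box_sum_point subrr normr0.
move=> /andP[pD uD]; exists (fun n => T D (set_index j p n)); split.
  by move=> n; exact: IHD.
exact: section_sum_series.
Qed.

(** * Full cubes and the Pringsheim sum *)

Lemma section_sum_full D j n : (forall p, p \in D) ->
  section_sum D j n = partial_sum c [ffun=> n].
Proof.
by move=> hD; congr box_sum; apply/ffunP => p; rewrite !ffunE hD.
Qed.

Lemma pringsheim_section_sum D j s : regular_cvg c -> (forall p, p \in D) ->
  section_sum D j @ \oo --> (s : R[i]^o) -> pringsheim_cvg c s.
Proof.
move=> hc hD /cvg_complexP cs e e0.
(* The available bounds are not strict; two quarters leave a margin below [e]. *)
have e40 : 0 < e / 4 by rewrite divr_gt0.
have [L1 cL1] := regular_cvg_box_sum hc e40.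
have [L2 cL2] := cs _ e40.
(* The cube of side [N] contains the box of [l], and its sum is close to [s]. *)
exists L1 => l lL; pose N := maxn (\max_p l p) L2.
rewrite (@le_lt_trans _ _ (e / 4 + e / 4)%:C)//; last first.
  by rewrite ltcR -mulrDr gtr_pMr//; lra.
rewrite -(subrKA (section_sum D j N)) (le_trans (ler_normD _ _))//.
rewrite raddfD lerD ?cL2 ?leq_maxr// distrC section_sum_full//.
apply: cL1 => q; rewrite !ffunE//; last by right; exact: ltnW.
by rewrite (leq_trans _ (leq_maxl _ _))//; exact: leq_bigmax.
Qed.

(** Cubes of side above [L] are among the boxes that the Pringsheim condition controls, so their
    sums can only tend to [s]. *)
Lemma pringsheim_section_sum_unique D j s t : (forall p, p \in D) ->
  pringsheim_cvg c s -> section_sum D j @ \oo --> (t : R[i]^o) -> t = s.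
Proof.
move=> hD ps ct; apply/eqP; rewrite -subr_eq0 -normr_le0 normc_def lecR.
apply/ler_addgt0Pl => e e0; rewrite addr0 -lecR -normc_def.
have [L cL] := ps _ e0.
apply: (cvg_dist_le (L := L.+1) ct) => n Ln.
by rewrite section_sum_full// ltW// cL// => p; rewrite ffunE.
Qed.

End Boxes.

Theorem theorem2p1 (R : realType) (m : nat) (hm : (2 <= m)%N)
    (c : {ffun 'I_m -> nat} -> R[i]) (hc : regular_cvg c) :
  (exists s : R[i], pringsheim_cvg c s) /\
  (forall s : R[i], pringsheim_cvg c s ->
    forall sigma : 'S_m,
      successive_sum c [seq sigma p | p <- enum 'I_m] [ffun=> 0%N] s).
Proof.
(* The limits are chosen for all [D] and [j] at once, since the induction passes through every tail
   of the list with varying frozen indices. *)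
have /choice[T cT] : forall Dj : seq 'I_m * multi_index m,
    exists s, section_sum c Dj.1 Dj.2 @ \oo --> (s : R[i]^o).
  by move=> [D j]; exact: section_sum_cvg.
split.
  exists (T (enum 'I_m, [ffun=> 0%N])).
  by apply: pringsheim_section_sum (cT _) => // p; rewrite mem_enum.
move=> s ps sigma; set D := map _ _.
have D_full p : p \in D.
  by apply/mapP; exists (sigma^-1%g p); rewrite ?mem_enum// permKV.
have <- := pringsheim_section_sum_unique D_full ps (cT (D, [ffun=> 0%N])).
apply: (successive_section_sum (T := fun D j => T (D, j))) => //.
  by move=> D' j; exact: (cT (D', j)).
by rewrite map_inj_uniq ?enum_uniq//; exact: perm_inj.
Qed.
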